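(* There exist finite constants $\underline{\beta}>0$ and $\bar{\beta}>0$, depending only on $A$, $\mathbf h$ and $\mathbf b$, such that for every $k\in\{1,\dots,K\}$ and any given values of $\mathbf y^{k+1},\dots,\mathbf y^K$ ($\mathbf y^l\in\mathbb R^{n_l}$) and $\mathbf x\in\mathbb R^m$, if $\mathbf y^{k*}=(y^*_{\bar n_{k-1}+1},\dots,y^*_{\bar n_k})$ is an optimal solution of the stage-$k$ problem, i.e. if $$\mathbf h^k\cdot\mathbf y^{k*}+\mathbf E[\varphi^{k-1}(\mathbf y^{k*},\mathbf y^{k+1},\dots,\mathbf y^K,\mathbf x+\mathbf D^k)]$$ attains the value $\varphi^k(\mathbf y^{k+1},\dots,\mathbf y^K,\mathbf x)$, then for all $\bar n_{k-1}<j\le\bar n_k$, $$-\underline{\beta}\Big(\|\mathbf x\|_1+\mathbf E\big[\|\underline{\mathbf D}^k\|_1\big]+\sum_{l=k+1}^K\|\mathbf y^l\|_1\Big)\le y_j^*\le\bar\beta\Big(\|\mathbf x\|_1+\mathbf E\big[\|\underline{\mathbf D}^k\|_1\big]+1\Big).$$ (For $k=K$ there are no $\mathbf y^l$ with $l>K$, $\mathbf x=\mathbf 0$, and $\varphi^K$ is a number.)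
   Context: There are $m$ products and $n$ components. $A=(a_{ji})$ is an $n\times m$ non-negative integer matrix with at least one non-zero entry in every row and every column. The $n$ components are partitioned into $K$ consecutive groups of sizes $n_1,\dots,n_K$; $\bar n_0=0$, $\bar n_k=\sum_{k'\le k}n_{k'}$, $\bar n_K=n$. $A^k$ is the submatrix of rows $\bar n_{k-1}+1,\dots,\bar n_k$ of $A$. Costs: $\mathbf h=(h_1,\dots,h_n)$, $\mathbf b=(b_1,\dots,b_m)$ have strictly positive entries, $\mathbf h^k=(h_{\bar n_{k-1}+1},\dots,h_{\bar n_k})$, and $\mathbf c=\mathbf b+\sum_{k=1}^K(A^k)'\mathbf h^k$ (prime denotes transpose). Demand: lead times $0=L_0<L_1<\dots<L_K$; demand is an $m$-dimensional compound Poisson process $\mathcal D(t)$, $t\ge -L_K$, with i.i.d. non-negative integer-valued order-size vectors $\mathbf S=(S_1,\dots,S_m)$ (coordinates possibly dependent) with $\mathbf E[S_i^6]<\infty$. $\mathbf D^1,\dots,\mathbf D^K$ are independent random vectors, $\mathbf D^k$ having the distribution of $\mathcal D(t-L_{k-1})-\mathcal D(t-L_k)$, and $\underline{\mathbf D}^k=\mathbf D^k+\dots+\mathbf D^1$. The multi-stage stochastic program is $$\varphi^K=\inf_{\mathbf y^K\in\mathbb R^{n_K}}\{\mathbf h^K\cdot\mathbf y^K+\mathbf E[\varphi^{K-1}(\mathbf y^K,\mathbf D^K)]\},$$ $$\varphi^k(\mathbf y^{k+1},\dots,\mathbf y^K,\mathbf x)=\inf_{\mathbf y^k\in\mathbb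 R^{n_k}}\{\mathbf h^k\cdot\mathbf y^k+\mathbf E[\varphi^{k-1}(\mathbf y^k,\dots,\mathbf y^K,\mathbf x+\mathbf D^k)]\},\quad 1\le k<K,$$ $$\varphi^0(\mathbf y^1,\dots,\mathbf y^K,\mathbf x)=-\max_{\mathbf z\in\mathbb R^m}\{\mathbf c\cdot\mathbf z\mid\mathbf z\le\mathbf x,\ A^k\mathbf z\le\mathbf y^k,\ 1\le k\le K\}.$$ *)

(* Defs.v *)
From HB Require Import structures.
From mathcomp Require Import all_boot all_order all_algebra.
From mathcomp Require Import all_classical all_reals all_analysis.

Set Implicit Arguments.
Unset Strict Implicit.
Unset Printing Implicit Defensive.

Import Order.TTheory GRing.Theory Num.Theory.
Import numFieldNormedType.Exports.

Local Open Scope classical_set_scope.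
Local Open Scope ring_scope.

Definition dot {R : realType} {n : nat} (u v : 'cV[R]_n) : R :=
  \sum_(i < n) u i 0 * v i 0.

Definition norm1 {R : realType} {n : nat} (u : 'cV[R]_n) : R :=
  \sum_(i < n) `|u i 0|.

Definition le_cV {R : realType} {n : nat} (u v : 'cV[R]_n) : Prop :=
  forall i : 'I_n, u i 0 <= v i 0.

Definition natmx {R : realType} {p q : nat} (A : 'M[nat]_(p, q)) : 'M[R]_(p, q) :=
  map_mx (fun a : nat => a%:R) A.

(* Demand vectors take values in N^m, represented by the measurable type
   [m.-tuple nat]; [vecR] is the inclusion of N^m into R^m. *)
Definition vecR {R : realType} {m : nat} (v : m.-tuple nat) : 'cV[R]_m :=
  \col_(i < m) (tnth v i)%:R.

(* The subtraction is truncated; it is only applied to u >= v componentwise. *)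
Definition tuple_sub {m : nat} (u v : m.-tuple nat) : m.-tuple nat :=
  [tuple (tnth u i - tnth v i)%N | i < m].

Definition same_law {R : realType} {d d' e : measure_display}
    {T : measurableType d} {T' : measurableType d'} {U : measurableType e}
    (P : probability T R) (X : T -> U) (Q : probability T' R) (Y : T' -> U) : Prop :=
  forall B : set U, measurable B -> pushforward P X B = pushforward Q Y B.

Definition mutually_independent {R : realType} {d e : measure_display}
    {T : measurableType d} {U : measurableType e} {I : eqType}
    (P : probability T R) (X : I -> T -> U) : Prop :=
  forall (J : seq I) (B : I -> set U), uniq J -> (forall i, measurable (B i)) ->
    P (\bigcap_(i in [set` J]) (X i @^-1` B i)) =
    (\prod_(i <- J) P (X i @^-1` B i))%E.

(* The sigma-algebra generated by the X i with i in D. *)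
Definition sigma_family {d e : measure_display} {T : measurableType d}
    {U : measurableType e} {I : Type} (D : set I) (X : I -> T -> U) : set (set T) :=
  <<s \bigcup_(i in D) preimage_set_system setT (X i) measurable >>.

Definition independent_systems {R : realType} {d : measure_display}
    {T : measurableType d} (P : probability T R) (F G : set (set T)) : Prop :=
  forall A B : set T, F A -> G B -> P (A `&` B) = (P A * P B)%E.

Record poisson_process {R : realType} {d : measure_display} {T : measurableType d}
    (Q : probability T R) (t0 rate : R) (N : R -> T -> nat) : Prop := {
  poisson_process_measurable : forall t, t0 <= t -> measurable_fun setT (N t);
  poisson_process_start : forall w, N t0 w = 0%N;
  poisson_process_nondecreasing : forall w s t, t0 <= s -> s <= t -> (N s w <= N t w)%N;
  poisson_process_right_continuous : forall w t, t0 <= t ->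
    \forall s \near t^'+, N s w = N t w;
  poisson_process_indep_increments : forall t : nat -> R,
    (forall i, t0 <= t i /\ t i <= t i.+1) ->
    mutually_independent Q (fun (i : nat) w => (N (t i.+1) w - N (t i) w)%N);
  poisson_process_law : forall s t (k : nat), t0 <= s -> s < t ->
    Q [set w | (N t w - N s w)%N = k] = (poisson_pmf (rate * (t - s)) k)%:E
}.

(* [N t] counts the orders placed in ]t0, t], [S i] is the size of order i
   (numbered from 0), [X t] is the cumulative demand in ]t0, t]. *)
Record compound_poisson_process {R : realType} {d : measure_display}
    {T : measurableType d} {m : nat} (Q : probability T R) (t0 rate : R)
    (N : R -> T -> nat) (S : nat -> {RV Q >-> m.-tuple nat})
    (X : R -> T -> m.-tuple nat) : Prop := {
  compound_poisson_rate : 0 < rate;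
  compound_poisson_count : poisson_process Q t0 rate N;
  compound_poisson_sizes_indep : mutually_independent Q (fun i w => S i w);
  compound_poisson_sizes_same_law : forall i, same_law Q (S i) Q (S 0%N);
  compound_poisson_count_sizes_indep :
    independent_systems Q (sigma_family [set t | t0 <= t] N)
                          (sigma_family setT (fun i w => S i w));
  compound_poisson_sum : forall t w, t0 <= t ->
    X t w = [tuple (\sum_(i < N t w) tnth (S i w) j)%N | j < m]
}.

(* The K groups of components are indexed by 'I_K; the ordinal k stands for group
   and stage k.+1. A, h are cut into the blocks A^k, h^k of [ns k] consecutive rows
   by [submxcol]. *)

Definition block_cost {R : realType} {m K : nat} {ns : 'I_K -> nat}
    (A : 'M[R]_((\sum_k ns k)%N, m)) (h : 'cV[R]_(\sum_k ns k)%N) (b : 'cV[R]_m) :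
    'cV[R]_m :=
  b + \sum_(k < K) (submxcol A k)^T *m submxcol h k.

Definition phi0 {R : realType} {m K : nat} {ns : 'I_K -> nat}
    (A : 'M[R]_((\sum_k ns k)%N, m)) (h : 'cV[R]_(\sum_k ns k)%N) (b : 'cV[R]_m)
    (y : forall k : 'I_K, 'cV[R]_(ns k)) (x : 'cV[R]_m) : \bar R :=
  (- ereal_sup [set (dot (block_cost A h b) z)%:E | z in
       [set z : 'cV[R]_m | le_cV z x /\
                           forall k : 'I_K, le_cV (submxcol A k *m z) (y k)]])%E.

(* The objective of stage k.+1 at the decision v, when V is the value function of
   the preceding stage k. *)
Definition stage_cost {R : realType} {d : measure_display} {T : measurableType d}
    {m K : nat} {ns : 'I_K -> nat} (P : probability T R)
    (D : 'I_K -> {RV P >-> m.-tuple nat}) (h : 'cV[R]_(\sum_k ns k)%N)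
    (V : (forall l : 'I_K, 'cV[R]_(ns l)) -> 'cV[R]_m -> \bar R) (k : 'I_K)
    (y : forall l : 'I_K, 'cV[R]_(ns l)) (x : 'cV[R]_m) (v : 'cV[R]_(ns k)) : \bar R :=
  ((dot (submxcol h k) v)%:E + \int[P]_w V (@eqtype.dfwith _ _ y k v) (x + vecR (D k w))%R)%E.

(* [phi s y x] is the value function phi^s for s <= K. It takes a whole family y
   but only depends on the blocks of the stages s+1, ..., K: the other ones are
   overwritten by the successive decisions. The dummy value 0 is only
   used for s > K. *)
Fixpoint phi {R : realType} {d : measure_display} {T : measurableType d}
    {m K : nat} {ns : 'I_K -> nat} (P : probability T R)
    (D : 'I_K -> {RV P >-> m.-tuple nat})
    (A : 'M[R]_((\sum_k ns k)%N, m)) (h : 'cV[R]_(\sum_k ns k)%N) (b : 'cV[R]_m)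
    (s : nat) (y : forall l : 'I_K, 'cV[R]_(ns l)) (x : 'cV[R]_m) : \bar R :=
  if s is s'.+1 then
    if insub s' is Some k then
      ereal_inf (range (stage_cost D h (phi D A h b s') (k := k) y x))
    else 0%E
  else phi0 A h b y x.

Lemma phiS {R : realType} {d : measure_display} {T : measurableType d}
    {m K : nat} {ns : 'I_K -> nat} (P : probability T R)
    (D : 'I_K -> {RV P >-> m.-tuple nat})
    (A : 'M[R]_((\sum_k ns k)%N, m)) (h : 'cV[R]_(\sum_k ns k)%N) (b : 'cV[R]_m)
    (k : 'I_K) (y : forall l : 'I_K, 'cV[R]_(ns l)) (x : 'cV[R]_m) :
  phi D A h b k.+1 y x =
  ereal_inf (range (fun v : 'cV[R]_(ns k) => stage_cost D h (phi D A h b k) y x v)).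
Proof. by rewrite /= valK. Qed.

(* Main.v *)
Require Import Defs.
From HB Require Import structures.
From mathcomp Require Import all_boot all_order all_algebra.
From mathcomp Require Import all_classical all_reals all_analysis.
From mathcomp Require Import measurable_realfun lra.

Set Implicit Arguments.
Unset Strict Implicit.
Unset Printing Implicit Defensive.

Import Order.TTheory GRing.Theory Num.Theory.
Import numFieldNormedType.Exports.

Local Open Scope classical_set_scope.
Local Open Scope ring_scope.

(** Each value function is a one-stage integral of the preceding one, and every estimate
    below is affine in |x|_1, so that integrating it against D^l merely adds E|D^l|_1.
    If one of these means with l <= k is infinite, both bounds hold trivially.

    Lower bound on a decision. With c = b + A'h, the total cost of production z is
    h.(y - Az) + b.(x - z) - b.x, and both slacks are nonnegative. A component j with
    y_j very negative forces (Az)_j <= y_j, hence a backlog b.(x - z) at least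
    proportional to - y_j. This estimate passes through all stages ([phi0_ge],
    [stage_cost_ge]). On the other hand, setting all undecided capacities to 0 shows
    that the optimal value is at most a constant times |x|_1 + sum_l E|D^l|_1 +
    sum_l |y^l|_1 ([phi0_le], [phi_le_ceil]). Comparing the two bounds y*_j from below
    ([optimal_decision_ge]); they also show that the value functions are finite and of
    affine growth, which makes all the integrals legitimate ([phi_sandwiched]).

    Upper bound on a decision. It may not depend on the given y^l, so the crude
    comparison above is useless; the decision is compared with itself, the coordinate
    j being cut from y*_j to a smaller M > 0. This saves exactly h_j (y*_j - M). Since
    (Az)_j <= a |x|_1, the capacity above M is of use only if a |x|_1 > M, and a
    Markov-type inequality bounds the loss by
    ctot a (y*_j - M) / M (|x|_1 + sum_l E|D^l|_1), ctot being the sum of the entries of c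
    ([phi0_cut], [phi_cut]). Optimality then gives
    h_j M <= ctot a (|x|_1 + sum_l E|D^l|_1) for every M < y*_j
    ([optimal_decision_le]). *)

(** * Norms and scalar products of column vectors *)

Section VectorBounds.
Context {R : realType}.
Implicit Types (n m : nat).

Lemma norm1_ge0 n (u : 'cV[R]_n) : 0 <= norm1 u.
Proof. exact: sumr_ge0. Qed.

Lemma norm10 n : norm1 (0 : 'cV[R]_n) = 0.
Proof. by apply: big1 => i _; rewrite mxE normr0. Qed.

Lemma ler_norm1D n (u v : 'cV[R]_n) : norm1 (u + v) <= norm1 u + norm1 v.
Proof.
by rewrite -big_split; apply: ler_sum => i _; rewrite mxE ler_normD.
Qed.

Lemma ler_coord_norm1 n (u : 'cV[R]_n) i : `|u i 0| <= norm1 u.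
Proof. by rewrite /norm1 (bigD1 i) //= lerDl sumr_ge0. Qed.

Lemma ler_dot_norm1 n (c u : 'cV[R]_n) (M : R) :
  (forall i, 0 <= c i 0 <= M) -> `|dot c u| <= M * norm1 u.
Proof.
move=> cM; rewrite /norm1 mulr_sumr; apply: le_trans (ler_norm_sum _ _ _) _.
apply: ler_sum => i _; have /andP[c0 cM'] := cM i.
by rewrite normrM (ger0_norm c0) ler_wpM2r.
Qed.

Lemma dotDl n (u v w : 'cV[R]_n) : dot (u + v) w = dot u w + dot v w.
Proof. by rewrite -big_split; apply: eq_bigr => i _; rewrite mxE mulrDl. Qed.

Lemma dotBr n (u v w : 'cV[R]_n) : dot u (v - w) = dot u v - dot u w.
Proof.
by rewrite -sumrB; apply: eq_bigr => i _; rewrite !mxE mulrBr.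
Qed.

Lemma dot_suml n I (r : seq I) (Q : pred I) (F : I -> 'cV[R]_n) w :
  dot (\sum_(i <- r | Q i) F i) w = \sum_(i <- r | Q i) dot (F i) w.
Proof.
apply: (big_morph (fun u => dot u w)) => [u v|]; first exact: dotDl.
by apply: big1 => i _; rewrite mxE mul0r.
Qed.

Lemma dot_trmx_mul n m (M : 'M[R]_(n, m)) (u : 'cV[R]_n) (z : 'cV[R]_m) :
  dot (M^T *m u) z = dot u (M *m z).
Proof.
rewrite /dot; under eq_bigr do rewrite mxE mulr_suml.
rewrite exchange_big; apply: eq_bigr => i _; rewrite mxE mulr_sumr.
by apply: eq_bigr => j _; rewrite mxE mulrCA mulrA.
Qed.

Lemma dot_ge0 n (u v : 'cV[R]_n) :
  (forall i, 0 <= u i 0) -> (forall i, 0 <= v i 0) -> 0 <= dot u v.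
Proof. by move=> u0 v0; apply: sumr_ge0 => i _; apply: mulr_ge0. Qed.

Lemma exists_positive_lower_bound n (u : 'cV[R]_n) :
  (forall i, 0 < u i 0) -> exists2 e : R, 0 < e & forall i, e <= u i 0.
Proof.
move=> u0; have s0 : 0 <= \sum_i (u i 0)^-1.
  by apply: sumr_ge0 => i _; rewrite invr_ge0 ltW.
exists (1 + \sum_i (u i 0)^-1)^-1 => [|i]; first by rewrite invr_gt0; lra.
rewrite -[leRHS]invrK lef_pV2 ?posrE ?invr_gt0//; last lra.
rewrite (bigD1 i)//= addrCA lerDl addr_ge0//.
by apply: sumr_ge0 => j _; rewrite invr_ge0 ltW.
Qed.

End VectorBounds.

(** * Expectations of functions of a demand vector *)

Section DemandExpectation.
Context {R : realType} {d : measure_display} {T : measurableType d} {m : nat}.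
Variables (P : probability T R) (X : {RV P >-> m.-tuple nat}).

(** The type of demand vectors is countable: its sigma-algebra is discrete, so that
    measurability of the value functions is never an issue. *)
Lemma measurable_tuple_nat (B : set (m.-tuple nat)) : measurable B.
Proof.
apply: countable_measurable; last exact: countableP.
move=> t.
have -> : [set t] = \bigcap_(i in [set: 'I_m]) ((fun u => tnth u i) @^-1` [set tnth t i]).
  apply/seteqP; split => [u -> //|u h]; apply: eq_from_tnth => i; exact: h.
apply: fin_bigcap_measurable => [|i _]; first exact: finite_finset.
by rewrite -[X in measurable X]setTI; apply: measurable_tnth.
Qed.

Lemma measurable_demand_fun (F : m.-tuple nat -> \bar R) :
  measurable_fun setT (fun w => F (X w)).
Proof.
move=> _ B mB; rewrite setTI -[_ @^-1` _]/(X @^-1` (F @^-1` B)).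
rewrite -[X in measurable X]setTI.
by apply: measurable_funP => //; exact: measurable_tuple_nat.
Qed.

Definition mean_size : \bar R := 'E_P[fun w => norm1 (vecR (X w) : 'cV[R]_m)].

Lemma mean_size_ge0 : (0 <= mean_size)%E.
Proof.
by rewrite /mean_size unlock integral_ge0// => w _; rewrite lee_fin norm1_ge0.
Qed.

Definition affinely_bounded (F : m.-tuple nat -> \bar R) :=
  exists C : R, forall v, (`|F v| <= (C * (1 + norm1 (vecR v : 'cV[R]_m)))%:E)%E.

Lemma affine_bounds_affinely_bounded (F : m.-tuple nat -> \bar R) (a b a' b' : R) :
  (forall v, ((- (a + b * norm1 (vecR v : 'cV[R]_m)))%:E <= F v)%E) ->
  (forall v, (F v <= (a' + b' * norm1 (vecR v : 'cV[R]_m))%:E)%E) ->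
  affinely_bounded F.
Proof.
move=> lo hi; exists (`|a| + `|b| + `|a'| + `|b'|) => v.
have := lo v; have := hi v; case: (F v) => [r| |] //; rewrite !lee_fin => h1 h2.
have n0 := norm1_ge0 (vecR v : 'cV[R]_m); set n := norm1 _ in n0 h1 h2 *.
have bound (p q : R) : p + q * n <= (`|p| + `|q|) * (1 + n).
  have := ler_norm p; have := ler_norm q; have := normr_ge0 p; have := normr_ge0 q.
  by move=> *; nra.
have := bound a b; have := bound a' b'.
have ha := normr_ge0 a; have hb := normr_ge0 b.
have ha' := normr_ge0 a'; have hb' := normr_ge0 b'.
by rewrite ler_norml => *; apply/andP; split; nra.
Qed.

Hypothesis X_integrable : (mean_size < +oo)%E.

Lemma mean_sizeE : mean_size = (fine mean_size)%:E.
Proof.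
by rewrite fineK// ge0_fin_numE// mean_size_ge0.
Qed.

Lemma integrable_size :
  P.-integrable setT (fun w => (norm1 (vecR (X w) : 'cV[R]_m))%:E).
Proof.
apply/integrableP; split.
  exact: (measurable_demand_fun (fun v => (norm1 (vecR v))%:E)).
move: X_integrable; rewrite /mean_size unlock; congr (_ < _)%E.
by apply: eq_integral => w _; rewrite /= ger0_norm ?norm1_ge0.
Qed.

Lemma integrable_affine (a b : R) :
  P.-integrable setT (fun w => (a + b * norm1 (vecR (X w) : 'cV[R]_m))%:E).
Proof.
apply: (integrableD measurableT (finite_measure_integrable_cst P a measurableT)
  (integrableZl measurableT b integrable_size)).
Qed.

Lemma integral_affine (a b : R) :
  (\int[P]_w (a + b * norm1 (vecR (X w) : 'cV[R]_m))%:E)%E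
    = (a + b * fine mean_size)%:E.
Proof.
have ia : P.-integrable setT (cst a%:E) := finite_measure_integrable_cst P a measurableT.
under eq_integral => w _ do rewrite EFinD EFinM -[a%:E]/(cst a%:E w).
rewrite (integralD measurableT ia (integrableZl measurableT b integrable_size)).
rewrite (integral_cst P measurableT) /= probability_setT mule1.
rewrite (integralZl measurableT integrable_size) EFinD EFinM -mean_sizeE.
by rewrite /mean_size [in RHS]unlock.
Qed.

Lemma integrable_affinely_bounded F : affinely_bounded F ->
  P.-integrable setT (fun w => F (X w)).
Proof.
move=> [C FC]; apply: (le_integrable measurableT (measurable_demand_fun F) _
  (integrable_affine C C)) => w _.
apply: le_trans (FC _) _; rewrite mulrDr mulr1 abse_EFin lee_fin; exact: ler_norm.
Qed.

(** Affine bounds make both sides integrable; otherwise the integral of an extended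
    real function need not be additive, as the difference of an infinite positive and
    an infinite negative part gets a conventional value. *)
Lemma expectation_le_affine (F G : m.-tuple nat -> \bar R) (a b : R) :
  affinely_bounded F -> affinely_bounded G ->
  (forall v, (F v <= G v + (a + b * norm1 (vecR v : 'cV[R]_m))%:E)%E) ->
  (\int[P]_w F (X w) <= \int[P]_w G (X w) + (a + b * fine mean_size)%:E)%E.
Proof.
move=> bF bG FG; rewrite -integral_affine.
have iG := integrable_affinely_bounded bG; have iA := integrable_affine a b.
rewrite -(integralD measurableT iG iA); apply: le_integral => //.
  exact: integrable_affinely_bounded.
exact: integrableD.
Qed.

Lemma affinely_bounded0 : affinely_bounded (fun=> 0%E).
Proof. by exists 0 => v; rewrite abse0 mul0r. Qed.

Lemma expectation_le (F : m.-tuple nat -> \bar R) (a b : R) :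
  affinely_bounded F ->
  (forall v, (F v <= (a + b * norm1 (vecR v : 'cV[R]_m))%:E)%E) ->
  (\int[P]_w F (X w) <= (a + b * fine mean_size)%:E)%E.
Proof.
move=> bF hF; rewrite -[leRHS]add0e -(integral0 P setT).
by apply: expectation_le_affine affinely_bounded0 _ => // v; rewrite add0e.
Qed.

Lemma expectation_ge (F : m.-tuple nat -> \bar R) (a b : R) :
  affinely_bounded F ->
  (forall v, ((- (a + b * norm1 (vecR v : 'cV[R]_m)))%:E <= F v)%E) ->
  ((- (a + b * fine mean_size))%:E <= \int[P]_w F (X w))%E.
Proof.
move=> bF hF; rewrite EFinN -[leLHS]add0e leeBlDr// -(integral0 P setT).
by apply: (expectation_le_affine affinely_bounded0) => // v; rewrite -leeBlDr// add0e -EFinN.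
Qed.

Lemma expectation_fin_num (F : m.-tuple nat -> \bar R) :
  affinely_bounded F -> (\int[P]_w F (X w))%E \is a fin_num.
Proof.
by move=> bF; apply: integrable_fin_num => //; apply: integrable_affinely_bounded.
Qed.

End DemandExpectation.

(** * The second-stage linear program *)

Section LinearProgram.
Context {R : realType} {m K : nat} {ns : 'I_K -> nat}.
Variables (A : 'M[R]_((\sum_k ns k)%N, m)) (h : 'cV[R]_(\sum_k ns k)%N).
Variable b : 'cV[R]_m.
Implicit Types (y : forall l : 'I_K, 'cV[R]_(ns l)) (x z : 'cV[R]_m).

Lemma dot_block_cost z :
  dot (block_cost A h b) z =
  dot b z + \sum_(l < K) dot (submxcol h l) (submxcol A l *m z).
Proof.
rewrite /block_cost dotDl dot_suml; congr (_ + _).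
by apply: eq_bigr => l _; rewrite dot_trmx_mul.
Qed.

Lemma block_costE : block_cost A h b = b + A^T *m h.
Proof.
rewrite /block_cost -[in RHS](submxcolK A) -[in RHS](submxcolK h) tr_mxcol.
by rewrite mul_mxrow_mxcol.
Qed.

Variables (a bmin ctot : R).
Hypothesis A_bounds : forall j i, 0 <= A j i <= a.
Hypothesis A_row_sum : forall j, 1 <= \sum_i A j i.
Hypothesis a_gt0 : 0 < a.
Hypothesis h_ge0 : forall j, 0 <= h j 0.
Hypothesis bmin_gt0 : 0 < bmin.
Hypothesis b_ge : forall i, bmin <= b i 0.
Hypothesis cost_le : \sum_i block_cost A h b i 0 <= ctot.

Lemma b_le_cost i : b i 0 <= block_cost A h b i 0.
Proof.
rewrite block_costE !mxE lerDl; apply: sumr_ge0 => j _; rewrite !mxE.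
by rewrite mulr_ge0//; have /andP[] := A_bounds j i.
Qed.

Lemma cost_ge0 i : 0 <= block_cost A h b i 0.
Proof. by rewrite (le_trans _ (b_le_cost i))// (le_trans (ltW bmin_gt0)). Qed.

Lemma cost_bounds i : 0 <= block_cost A h b i 0 <= ctot.
Proof.
rewrite cost_ge0 (le_trans _ cost_le)// (bigD1 i)//= lerDl.
by apply: sumr_ge0 => j _; exact: cost_ge0.
Qed.

Lemma ctot_ge0 : 0 <= ctot.
Proof. by apply: le_trans cost_le; apply: sumr_ge0 => i _; exact: cost_ge0. Qed.

Lemma ler_row_norm1 l (p : 'I_(ns l)) z :
  `|(submxcol A l *m z) p 0| <= a * norm1 z.
Proof.
rewrite mxE mulr_sumr; apply: le_trans (ler_norm_sum _ _ _) _.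
apply: ler_sum => i _; rewrite mxE normrM.
have /andP[A0 Aa] := A_bounds (tagnat.Rank l p) i.
by rewrite (ger0_norm A0) ler_wpM2r.
Qed.

(** Row sums of A are at least 1, so lowering all products by t frees at least t units
    of every component. *)
Lemma row_shift l (p : 'I_(ns l)) z (t : R) : 0 <= t ->
  (submxcol A l *m (z - const_mx t)) p 0 <= (submxcol A l *m z) p 0 - t.
Proof.
move=> t0; rewrite mulmxBr 2!mxE lerD2l mxE lerN2 mxE.
under eq_bigr do rewrite !mxE.
by rewrite -mulr_suml ler_peMl.
Qed.

Lemma dot_cost_shift z (t : R) : 0 <= t ->
  dot (block_cost A h b) z - ctot * t
    <= dot (block_cost A h b) (z - const_mx t).
Proof.
move=> t0; rewrite dotBr lerD2l lerN2 /dot.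
by under eq_bigr do rewrite [const_mx _ _ _]mxE; rewrite -mulr_suml ler_wpM2r.
Qed.

(** Adding h.y to phi^0 gives the minimum of h.(y - Az) + b.(x - z) - b.x, where both
    slacks are nonnegative. As (Az)_p <= y_p, the entries of x - z sum up to at least
    - y_p / a - |x|, which bounds the backlog b.(x - z) from below. *)
Lemma phi0_ge y x l0 (p : 'I_(ns l0)) :
  ((- (\sum_(l < K) dot (submxcol h l) (y l) + bmin / a * y l0 p 0
       + (ctot + bmin) * norm1 x))%:E <= phi0 A h b y x)%E.
Proof.
rewrite /phi0 EFinN leeN2; apply: ge_ereal_sup => _ [z [zx zy] <-].
rewrite lee_fin dot_block_cost.
have holding : \sum_(l < K) dot (submxcol h l) (submxcol A l *m z)
    <= \sum_(l < K) dot (submxcol h l) (y l).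
  apply: ler_sum => l _; rewrite -subr_ge0 -dotBr; apply: dot_ge0 => q.
    by rewrite mxE.
  by rewrite !mxE subr_ge0; have := zy l q; rewrite mxE.
have slack0 i : 0 <= (x - z) i 0 by rewrite !mxE subr_ge0.
have backlog : bmin * norm1 (x - z) <= dot b x - dot b z.
  rewrite -dotBr /norm1 mulr_sumr; apply: ler_sum => i _.
  by rewrite (ger0_norm (slack0 i)) ler_wpM2r.
have bx : dot b x <= ctot * norm1 x.
  apply: le_trans (ler_norm _) _; apply: ler_dot_norm1 => i.
  rewrite (le_trans (ltW bmin_gt0) (b_ge i)) (le_trans (b_le_cost i))//.
  by have /andP[] := cost_bounds i.
have low : - y l0 p 0 <= a * norm1 x + a * norm1 (x - z).
  have := zy l0 p; have := ler_row_norm1 p x; have := ler_row_norm1 p (x - z).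
  have -> : (submxcol A l0 *m (x - z)) p 0
      = (submxcol A l0 *m x) p 0 - (submxcol A l0 *m z) p 0.
    by rewrite mulmxBr !mxE.
  by rewrite 2!ler_norml; lra.
have {}low : - (bmin / a * y l0 p 0) <= bmin * norm1 x + bmin * norm1 (x - z).
  have := ler_wpM2l (divr_ge0 (ltW bmin_gt0) (ltW a_gt0)) low.
  by rewrite mulrN mulrDr !mulrA divfK ?gt_eqF.
rewrite mulrDl; lra.
Qed.

(** Producing - t of every product, with t the size of all the data, is feasible since
    each component is used at least once. *)
Lemma phi0_le y x :
  (phi0 A h b y x <= (ctot * (norm1 x + \sum_(l < K) norm1 (y l)))%:E)%E.
Proof.
set t := norm1 x + _.
have Y0 : 0 <= \sum_(l < K) norm1 (y l) by apply: sumr_ge0 => l _; exact: norm1_ge0.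
have t0 : 0 <= t by rewrite addr_ge0// norm1_ge0.
rewrite /phi0 leeNl -EFinN; apply: le_trans (ereal_sup_ubound _).
  2: { exists (0 - const_mx t); last by []. split=> [i|l p].
    rewrite !mxE sub0r lerNl; have := ler_coord_norm1 x i.
    by rewrite ler_norml => /andP[? _]; rewrite /t; lra.
  apply: le_trans (row_shift p 0 t0) _; rewrite mulmx0 mxE sub0r.
  have : norm1 (y l) <= \sum_(l < K) norm1 (y l).
    by rewrite (bigD1 l)//= lerDl; apply: sumr_ge0 => ? _; exact: norm1_ge0.
  have := ler_coord_norm1 (y l) p; rewrite ler_norml => /andP[? _].
  by have := norm1_ge0 x; rewrite /t; lra. }
rewrite lee_fin; apply: le_trans (dot_cost_shift 0 t0).
by rewrite /dot big1 ?sub0r// => i _; rewrite [X in _ * X]mxE mulr0.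
Qed.

(** A feasible z needs at most a |x| of each component, so a cut down to M hurts only
    if a |x| > M; then lowering every product by [cut] restores feasibility. Lowering
    by cut * (a |x| / M) covers both cases, and its cost is linear in |x|: this makes
    the bound stable under expectation. *)
Lemma phi0_cut y y' x (M cut : R) : 0 < M -> 0 <= cut ->
  (forall l p, Num.min (y l p 0) M <= y' l p 0) ->
  (forall l p, y l p 0 - cut <= y' l p 0) ->
  (phi0 A h b y' x
     <= phi0 A h b y x + (ctot * a * cut / M * norm1 x)%:E)%E.
Proof.
move=> M0 cut0 yM ycut; pose t := a * norm1 x / M * cut.
have W0 : 0 <= a * norm1 x by rewrite mulr_ge0 ?norm1_ge0// ltW.
have t0 : 0 <= t by rewrite mulr_ge0// divr_ge0// ltW.
have -> : ctot * a * cut / M * norm1 x = ctot * t.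
  by rewrite /t -!mulrA; congr (_ * (_ * _)); rewrite mulrA mulrC [_ / M]mulrC mulrA.
rewrite /phi0 -leeBlDr// -fin_num_oppeD// leeN2; apply: ge_ereal_sup => _ [z [zx zy] <-].
rewrite -leeBlDr// -EFinB.
apply: le_trans (ereal_sup_ubound _); last first.
  exists (z - const_mx t); last by []; split=> [i|l p].
    by rewrite !mxE (le_trans _ (zx i))// lerBlDr lerDl.
  apply: le_trans (row_shift p z t0) _.
  have [WM|MW] := leP (a * norm1 x) M.
    apply: le_trans (yM l p); rewrite lerBlDr ler_wpDr// le_min zy /=.
    apply: le_trans WM; apply: le_trans (le_trans (ler_norm _) (ler_row_norm1 p x)).
    rewrite !mxE; apply: ler_sum => i _; rewrite ler_wpM2l// mxE.
    by have /andP[] := A_bounds (tagnat.Rank l p) i.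
  apply: le_trans (ycut l p); apply: lerB (zy l p) _.
  by rewrite /t ler_peMl// ler_pdivlMr// mul1r ltW.
by rewrite lee_fin dot_cost_shift.
Qed.

End LinearProgram.

(** * Bounds on the value functions and on optimal decisions *)

Section Stages.
Context {R : realType} {m K : nat} {ns : 'I_K -> nat}.
Context {d : measure_display} {T : measurableType d} (P : probability T R).
Variable D : 'I_K -> {RV P >-> m.-tuple nat}.
Variables (A : 'M[R]_((\sum_k ns k)%N, m)) (h : 'cV[R]_(\sum_k ns k)%N).
Variable b : 'cV[R]_m.
Implicit Types (y : forall l : 'I_K, 'cV[R]_(ns l)) (x : 'cV[R]_m).

Variables (a bmin ctot hmax : R).
Hypothesis A_bounds : forall j i, 0 <= A j i <= a.
Hypothesis A_row_sum : forall j, 1 <= \sum_i A j i.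
Hypothesis a_gt0 : 0 < a.
Hypothesis h_bounds : forall j, 0 <= h j 0 <= hmax.
Hypothesis bmin_gt0 : 0 < bmin.
Hypothesis b_ge : forall i, bmin <= b i 0.
Hypothesis cost_le : \sum_i block_cost A h b i 0 <= ctot.

Variables (k : 'I_K) (p : 'I_(ns k)).
Hypothesis D_integrable : forall l : 'I_K, (l <= k)%N -> (mean_size (D l) < +oo)%E.

Notation update y l v := (@eqtype.dfwith _ _ y l v).

Definition future_mean s : R := \sum_(l < K | (l < s)%N) fine (mean_size (D l)).
Definition paid y s : R := \sum_(l < K | (s <= l)%N) dot (submxcol h l) (y l).
Definition volume y s : R := \sum_(l < K | (s <= l)%N) norm1 (y l).

Let h_ge0 j : 0 <= h j 0.
Proof. by have /andP[] := h_bounds j. Qed.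

Let C0 : 0 <= ctot.
Proof. exact: ctot_ge0 A_bounds h_ge0 bmin_gt0 b_ge cost_le. Qed.

Lemma future_mean_ge0 s : 0 <= future_mean s.
Proof.
by apply: sumr_ge0 => l _; rewrite fine_ge0// mean_size_ge0.
Qed.

Lemma future_mean0 : future_mean 0 = 0.
Proof. exact: big_pred0. Qed.

Lemma future_meanS (l : 'I_K) :
  future_mean l.+1 = future_mean l + fine (mean_size (D l)).
Proof.
rewrite /future_mean (bigD1 l)//= addrC; congr (_ + _).
by apply: eq_bigl => j; rewrite ltnS [RHS]ltn_neqAle andbC.
Qed.

Lemma sum_update (F : forall l : 'I_K, 'cV[R]_(ns l) -> R) y (l : 'I_K) v :
  \sum_(j < K | (l <= j)%N) F j (update y l v j)
    = F l v + \sum_(j < K | (l < j)%N) F j (y j).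
Proof.
rewrite (bigD1 l)//= dfwith_in; congr (_ + _); apply: eq_big => [j|j].
  by rewrite ltn_neqAle andbC eq_sym.
by move=> /andP[_ jl]; rewrite dfwith_out// eq_sym.
Qed.

(* The slopes of [phi0_ge]. *)
Let kap := bmin / a.
Let C1 := ctot + bmin.

Let C1_ge0 : 0 <= C1.
Proof. by rewrite addr_ge0// ltW. Qed.

(** For s <= k these bounds depend, like phi^s itself, only on the blocks y^l with
    s <= l; the coordinate p of y^k, the one to be bounded, is singled out. *)
Definition value_floor s y x : R :=
  - (paid y s + kap * y k p 0 + C1 * (norm1 x + future_mean s)).
Definition value_ceil s y x : R :=
  ctot * (norm1 x + future_mean s + volume y s).

Definition sandwiched s := forall y x,
  ((value_floor s y x)%:E <= phi D A h b s y x)%E /\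
  (phi D A h b s y x <= (value_ceil s y x)%:E)%E.

Lemma value_floor_ge s y x u :
  - (paid y s + kap * y k p 0 + C1 * (norm1 x + future_mean s) + C1 * norm1 u)
    <= value_floor s y (x + u).
Proof.
have := ler_wpM2l C1_ge0 (ler_norm1D x u).
by rewrite /value_floor lerN2 !mulrDr; lra.
Qed.

Lemma value_ceil_le s y x u :
  value_ceil s y (x + u)
    <= ctot * (norm1 x + future_mean s + volume y s) + ctot * norm1 u.
Proof.
have := ler_wpM2l C0 (ler_norm1D x u).
by rewrite /value_ceil !mulrDr; lra.
Qed.

Lemma sandwiched_affinely_bounded s y x : sandwiched s ->
  affinely_bounded (fun v => phi D A h b s y (x + vecR v)).
Proof.
move=> H; apply: affine_bounds_affinely_bounded => v; have [lo hi] := H y (x + vecR v).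
  by apply: le_trans lo; rewrite lee_fin; exact: value_floor_ge.
by apply: le_trans hi _; rewrite lee_fin; exact: value_ceil_le.
Qed.

(** The cost of the decision v cancels against the block l of [paid], and the decision
    disappears from the bound unless l = k, where its coordinate p remains. *)
Lemma stage_cost_ge (l : 'I_K) y x v : (l <= k)%N -> sandwiched l ->
  ((- (paid y l.+1 + kap * update y l v k p 0
       + C1 * (norm1 x + future_mean l.+1)))%:E
     <= stage_cost D h (phi D A h b l) y x v)%E.
Proof.
move=> lk H; have bd := sandwiched_affinely_bounded (update y l v) x H.
have : forall u, ((- (paid (update y l v) l + kap * update y l v k p 0
    + C1 * (norm1 x + future_mean l) + C1 * norm1 (vecR u : 'cV[R]_m)))%:E
    <= phi D A h b l (update y l v) (x + vecR u))%E.
  move=> u; have [lo _] := H (update y l v) (x + vecR u).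
  by apply: le_trans lo; rewrite lee_fin value_floor_ge.
move=> /(expectation_ge (D_integrable lk) bd) I.
rewrite /stage_cost; apply: le_trans (leeD2l _ I); rewrite -EFinD lee_fin.
rewrite future_meanS /paid (sum_update (fun j u => dot (submxcol h j) u)).
by rewrite !mulrDr; lra.
Qed.

(** The decision 0 neither costs anything nor adds to [volume]. *)
Lemma phi_le_ceil (l : 'I_K) y x : (l <= k)%N -> sandwiched l ->
  (phi D A h b l.+1 y x <= (value_ceil l.+1 y x)%:E)%E.
Proof.
move=> lk H; rewrite phiS; apply: le_trans (ereal_inf_lbound _) _.
  by exists 0.
have bd := sandwiched_affinely_bounded (update y l 0) x H.
have : forall u, (phi D A h b l (update y l 0%R) (x + vecR u) <=
   (ctot * (norm1 x + future_mean l + volume (update y l 0%R) l)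
    + ctot * norm1 (vecR u : 'cV[R]_m))%:E)%E.
  move=> u; have [_ hi] := H (update y l 0) (x + vecR u).
  by apply: le_trans hi _; rewrite lee_fin value_ceil_le.
move=> /(expectation_le (D_integrable lk) bd) I.
rewrite /stage_cost; apply: le_trans (leeD2l _ I) _; rewrite -EFinD lee_fin.
rewrite /value_ceil future_meanS /volume (sum_update (fun j u => norm1 u)) norm10.
have -> : dot (submxcol h l) 0 = 0 by apply: big1 => i _; rewrite [X in _ * X]mxE mulr0.
by rewrite !mulrDr; lra.
Qed.

(** Both bounds are affine in |x| with slopes that do not grow with the stage, so
    taking expectations only turns the next demand into its mean size. *)
Lemma phi_sandwiched s : (s <= k)%N -> sandwiched s.
Proof.
elim: s => [_ y x|s IH sk y x].
  rewrite /value_floor /value_ceil future_mean0 !addr0; split.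
    exact: (phi0_ge A_bounds a_gt0 h_ge0 bmin_gt0 b_ge cost_le).
  exact: (phi0_le A_row_sum cost_le).
have sK : (s < K)%N by apply: ltn_trans (ltn_ord k).
have {}IH : sandwiched (Ordinal sK) by apply: IH; exact: ltnW.
have lk : (Ordinal sK <= k)%N by exact: ltnW.
split; last exact: (phi_le_ceil (l := Ordinal sK)).
rewrite -[s]/(nat_of_ord (Ordinal sK)) phiS; apply: le_ereal_inf_tmp => _ [v _ <-].
have := stage_cost_ge y x v lk IH.
by rewrite dfwith_out// -val_eqE /= neq_ltn sk.
Qed.

Section Cut.
Variables (M cut : R).
Hypothesis M_gt0 : 0 < M.
Hypothesis cut_ge0 : 0 <= cut.

(** Only capacities above M decrease, by at most [cut] and not below M. Stating this
    for all blocks at once makes the relation stable when both families are updated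
    with the same decision. *)
Definition cut_below y y' :=
  forall l q, Num.min (y l q 0) M <= y' l q 0 /\ y l q 0 - cut <= y' l q 0.

(* The slope of [phi0_cut]. *)
Let C3 := ctot * a * cut / M.

Definition cut_cost_bounded s := forall y y' x, cut_below y y' ->
  (phi D A h b s y' x
     <= phi D A h b s y x + (C3 * (norm1 x + future_mean s))%:E)%E.

Let C3_ge0 : 0 <= C3.
Proof. by rewrite divr_ge0 ?mulr_ge0// ltW. Qed.

Lemma expected_cut_cost (l : 'I_K) y y' x v v' : (l <= k)%N ->
  cut_cost_bounded l -> cut_below (update y l v) (update y' l v') ->
  (\int[P]_w phi D A h b l (update y' l v') (x + vecR (D l w))
   <= \int[P]_w phi D A h b l (update y l v) (x + vecR (D l w))
      + (C3 * (norm1 x + future_mean l.+1))%:E)%E.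
Proof.
move=> lk H yy'; have S := phi_sandwiched lk.
rewrite future_meanS addrA mulrDr.
apply: (expectation_le_affine (D_integrable lk)
  (sandwiched_affinely_bounded (update y' l v') x S)
  (sandwiched_affinely_bounded (update y l v) x S)) => u.
apply: le_trans (H _ _ (x + vecR u) yy') _; apply: leeD2l.
by rewrite lee_fin -mulrDr ler_wpM2l// addrAC lerD2r ler_norm1D.
Qed.

(** The cut system can copy, stage after stage, every decision of the original one. *)
Lemma phi_cut s : (s <= k)%N -> cut_cost_bounded s.
Proof.
elim: s => [_ y y' x yy'|s IH sk y y' x yy'].
  rewrite future_mean0 addr0; apply: (phi0_cut A_bounds A_row_sum a_gt0 cost_le)
    => // l q; by have [] := yy' l q.
have sK : (s < K)%N by apply: ltn_trans (ltn_ord k).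
have {}IH : cut_cost_bounded (Ordinal sK) by apply: IH; exact: ltnW.
have lk : (Ordinal sK <= k)%N by exact: ltnW.
rewrite -[s]/(nat_of_ord (Ordinal sK)) !phiS -leeBlDr//.
apply: le_ereal_inf_tmp => _ [v _ <-]; rewrite leeBlDr//.
apply: le_trans (ereal_inf_lbound _) _; first by exists v.
rewrite /stage_cost -addeA; apply: leeD2l; apply: expected_cut_cost => // l.
have [<-|nl] := eqVneq (Ordinal sK) l => q.
  by rewrite !dfwith_in ge_min lexx gerBl.
by rewrite !dfwith_out.
Qed.

End Cut.

Section Optimal.
Variables (y : forall l : 'I_K, 'cV[R]_(ns l)) (x : 'cV[R]_m) (v : 'cV[R]_(ns k)).
Hypothesis v_opt :
  stage_cost D h (phi D A h b k) y x v = phi D A h b k.+1 y x.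

Let S := phi_sandwiched (leqnn k).

(** The value of an optimal decision lies below [value_ceil], while its cost grows at
    least like - kap * v_p as v_p goes to -oo. *)
Lemma optimal_decision_ge :
  - (a / bmin * (2 * ctot + bmin + hmax)
      * (norm1 x + future_mean k.+1 + volume y k.+1)) <= v p 0.
Proof.
have := le_trans (stage_cost_ge y x v (leqnn k) S)
  (eq_ind_r (fun c => (c <= _)%E) (phi_le_ceil y x (leqnn k) S) v_opt).
rewrite lee_fin dfwith_in /value_ceil.
have paid_le : paid y k.+1 <= hmax * volume y k.+1.
  rewrite /paid /volume mulr_sumr; apply: ler_sum => l _.
  apply: le_trans (ler_norm _) _; apply: ler_dot_norm1 => q; rewrite mxE.
  exact: h_bounds.
have n0 := norm1_ge0 x; have f0 := future_mean_ge0 k.+1.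
have V0 : 0 <= volume y k.+1 by apply: sumr_ge0 => l _; exact: norm1_ge0.
have H0 : 0 <= hmax by have /andP[/le_trans] := h_bounds (tagnat.Rank k p); apply.
move: paid_le; set W := norm1 x + _; set V := volume _ _ => paid_le I.
have W0 : 0 <= W by rewrite addr_ge0.
have low : - (kap * v p 0) <= (2 * ctot + bmin + hmax) * (W + V).
  move: C0 (ltW bmin_gt0) I; rewrite /C1 => c0 b0 I.
  have : 0 <= hmax * W by rewrite mulr_ge0.
  have : 0 <= (ctot + bmin) * V by rewrite mulr_ge0// addr_ge0.
  by move: I; rewrite !mulrDl !mulrDr; lra.
have kap_gt0 : 0 < kap by rewrite divr_gt0.
rewrite -mulrA -invf_div -/kap lerNl -(ler_pM2l kap_gt0).
by rewrite mulrN mulVKf ?gt_eqF.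
Qed.

(** If v_p exceeded the bound B, cutting it to a level M between B and v_p would save
    h_p * cut and cost at most ctot * a * cut / M * W, which is less as M > B. *)
Lemma optimal_decision_le (hp_gt0 : 0 < submxcol h k p 0) :
  v p 0 <= ctot * a / submxcol h k p 0 * (norm1 x + future_mean k.+1).
Proof.
set hp := submxcol h k p 0 in hp_gt0 *; set W := norm1 x + _.
have W0 : 0 <= W by rewrite addr_ge0 ?norm1_ge0 ?future_mean_ge0.
set B := _ * W; have B0 : 0 <= B by rewrite mulr_ge0// divr_ge0 ?mulr_ge0// ltW.
rewrite leNgt; apply/negP => Bv.
pose M := (B + v p 0) / 2; have M0 : 0 < M by rewrite /M; lra.
pose cut := v p 0 - M; have cut0 : 0 < cut by rewrite /cut /M; lra.
pose v' := \col_q (if q == p then M else v q 0).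
have cutv : cut_below M cut (update y k v) (update y k v').
  move=> l; have [<-|nl] := eqVneq k l => q; last first.
    by rewrite !dfwith_out// ge_min lexx gerBl (ltW cut0).
  rewrite !dfwith_in mxE; case: eqP => [->|_]; last by rewrite ge_min lexx gerBl (ltW cut0).
  by rewrite ge_min lexx orbT /cut subKr.
have I := expected_cut_cost M0 (ltW cut0) x (leqnn k) (phi_cut M0 (ltW cut0) (leqnn k)) cutv.
have := ereal_inf_lbound (imageT (stage_cost D h (phi D A h b k) y x) v').
rewrite -phiS -v_opt /stage_cost => /le_trans /(_ (leeD2l _ I)).
have bd := sandwiched_affinely_bounded (update y k v) x S.
rewrite -(fineK (expectation_fin_num (D_integrable (leqnn k)) bd)) -!EFinD lee_fin.
have -> : dot (submxcol h k) v = dot (submxcol h k) v' + hp * cut.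
  apply/eqP; rewrite addrC -subr_eq -dotBr /dot (bigD1 p)//= big1 ?addr0.
    by rewrite /hp !mxE eqxx.
  by move=> q /negbTE qp; rewrite !mxE qp subrr mulr0.
rewrite -/W => J.
have {}J : hp * cut <= ctot * a * W / M * cut.
  by rewrite [leRHS]mulrAC -mulrA (mulrAC _ W) -mulrA; lra.
have : hp * M <= ctot * a * W by move: J; rewrite ler_pM2r// ler_pdivlMr.
have : hp * B = ctot * a * W by rewrite /B mulrA mulrCA divff ?gt_eqF// mulr1.
have : hp * B < hp * M by rewrite ltr_pM2l// /M; lra.
by lra.
Qed.

End Optimal.

End Stages.

(** * The expected size of the remaining demand *)

Section SumOfDemands.
Context {R : realType} {d : measure_display} {T : measurableType d} {m K : nat}.
Variables (P : probability T R) (D : 'I_K -> {RV P >-> m.-tuple nat}).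

(** Demands are nonnegative, so that sizes add up and linearity of expectation gives
    an equality, valid also when some mean is infinite. *)
Lemma expectation_norm1_sum (Q : pred 'I_K) :
  ('E_P[(fun w => norm1 (\sum_(l < K | Q l) vecR (D l w) : 'cV[R]_m))%R]
    = \sum_(l < K | Q l) mean_size (D l))%E.
Proof.
rewrite unlock.
transitivity (\int[P]_w (\sum_(l < K | Q l)
    (norm1 (vecR (D l w) : 'cV[R]_m))%:E))%E.
  apply: eq_integral => w _; rewrite sumEFin; congr EFin.
  rewrite /norm1 exchange_big; apply: eq_bigr => i _.
  rewrite summxE ger0_norm; last by apply: sumr_ge0 => l _; rewrite mxE.
  by apply: eq_bigr => l _; rewrite ger0_norm// mxE.
under eq_integral do rewrite -big_filter.
rewrite ge0_integral_sum// ?big_filter => [|l|l w _].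
- by apply: eq_bigr => l _; rewrite /mean_size unlock.
- exact: (measurable_demand_fun (D l) (fun v => (norm1 (vecR v))%:E)).
- by rewrite lee_fin norm1_ge0.
Qed.

Lemma expectation_norm1_future (k : 'I_K) :
  (forall l : 'I_K, (l <= k)%N -> (mean_size (D l) < +oo)%E) ->
  'E_P[(fun w => norm1 (\sum_(l < K | (l <= k)%N) vecR (D l w) : 'cV[R]_m))%R]%E
    = (future_mean D k.+1)%:E.
Proof.
move=> fin; rewrite expectation_norm1_sum /future_mean -sumEFin.
by apply: eq_bigr => l lk; rewrite -mean_sizeE// fin.
Qed.

Lemma expectation_norm1_future_infinite (k l : 'I_K) : (l <= k)%N ->
  ~~ (mean_size (D l) < +oo)%E ->
  'E_P[(fun w => norm1 (\sum_(l < K | (l <= k)%N) vecR (D l w) : 'cV[R]_m))%R]%E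
    = +oo%E.
Proof.
rewrite -leNgt leye_eq => lk /eqP oo; rewrite expectation_norm1_sum (bigD1 l)//= oo.
by rewrite addye// gt_eqF// (lt_le_trans (ltNyr 0))// sume_ge0// => j _; exact: mean_size_ge0.
Qed.

End SumOfDemands.

(** * The bounds on optimal decisions *)

Theorem theorem1 (R : realType) (n m : nat) (A : 'M[nat]_(n, m))
    (h : 'cV[R]_n) (b : 'cV[R]_m)
    (A_row : forall j : 'I_n, exists i : 'I_m, A j i <> 0%N)
    (A_col : forall i : 'I_m, exists j : 'I_n, A j i <> 0%N)
    (h_gt0 : forall j : 'I_n, 0 < h j 0)
    (b_gt0 : forall i : 'I_m, 0 < b i 0) :
  exists beta_low beta_up : R, 0 < beta_low /\ 0 < beta_up /\
  forall (K : nat) (ns : 'I_K -> nat) (n_eq : n = (\sum_(k < K) ns k)%N)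
    (L : nat -> R) (L0 : L 0%N = 0) (L_incr : forall k : 'I_K, L k < L k.+1)
    (* the demand process *)
    (d' : measure_display) (T' : measurableType d') (Q : probability T' R)
    (rate : R) (N : R -> T' -> nat) (S : nat -> {RV Q >-> m.-tuple nat})
    (Dem : R -> T' -> m.-tuple nat)
    (Dem_cpp : compound_poisson_process (- L K) rate N S Dem)
    (S_moment : forall i : 'I_m,
      ('E_Q[(fun w => (tnth (S 0%N w) i)%:R ^+ 6)%R] < +oo)%E)
    (* the random vectors D^1, ..., D^K *)
    (d : measure_display) (T : measurableType d) (P : probability T R)
    (D : 'I_K -> {RV P >-> m.-tuple nat})
    (D_indep : mutually_independent P (fun k w => D k w))
    (D_law : forall (k : 'I_K) (t : R), 0 <= t ->
      same_law P (D k) Q (fun w => tuple_sub (Dem (t - L k) w) (Dem (t - L k.+1) w))),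
  let A' : 'M[R]_((\sum_(k < K) ns k)%N, m) := castmx (n_eq, erefl m) (natmx A) in
  let h' : 'cV[R]_(\sum_(k < K) ns k)%N := castmx (n_eq, erefl 1%N) h in
  forall (k : 'I_K) (y : forall l : 'I_K, 'cV[R]_(ns l)) (x : 'cV[R]_m)
    (x_last : k.+1 = K -> x = 0)
    (ystar : 'cV[R]_(ns k))
    (ystar_opt : stage_cost D h' (phi D A' h' b k) y x ystar =
                 phi D A' h' b k.+1 y x),
  forall i : 'I_(ns k),
    (- (beta_low%:E *
         ((norm1 x)%:E +
          'E_P[(fun w => norm1 (\sum_(l < K | (l <= k)%N) vecR (D l w)))%R] +
          (\sum_(l < K | (k < l)%N) norm1 (y l))%R%:E))
       <= (ystar i 0)%:E)%E /\
    ((ystar i 0)%:E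
       <= beta_up%:E *
         ((norm1 x)%:E +
          'E_P[(fun w => norm1 (\sum_(l < K | (l <= k)%N) vecR (D l w)))%R] +
          1))%E.
Proof.
have [bmin bmin0 bge] := exists_positive_lower_bound b_gt0.
have [hmin hmin0 hge] := exists_positive_lower_bound h_gt0.
pose Ar : 'M[R]_(n, m) := natmx A.
have Ar0 j i : 0 <= Ar j i by rewrite mxE.
(* The summand 1 keeps a positive when A has no entry. *)
pose a := 1 + \sum_j \sum_i Ar j i.
have rows0 : 0 <= \sum_j \sum_i Ar j i by do 2! apply: sumr_ge0 => ? _.
have a0 : 0 < a by rewrite ltr_pwDl.
have A_bounds j i : 0 <= Ar j i <= a.
  rewrite Ar0 /a (bigD1 j)//= (bigD1 i)//=.
  have : 0 <= \sum_(i' | i' != i) Ar j i' by apply: sumr_ge0.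
  have : 0 <= \sum_(j' | j' != j) \sum_i Ar j' i by do 2! apply: sumr_ge0 => ? _.
  by lra.
have A_row_sum j : 1 <= \sum_i Ar j i.
  have [i Aji] := A_row j; rewrite (bigD1 i)//=; apply: ler_wpDr; first exact: sumr_ge0.
  by rewrite mxE ler1n lt0n; apply/eqP.
pose ctot := \sum_i (b + Ar^T *m h) i 0.
have ctot0 : 0 <= ctot.
  apply: sumr_ge0 => i _; rewrite !mxE addr_ge0 ?(ltW (b_gt0 i))//; apply: sumr_ge0 => j _.
  by rewrite mxE mulr_ge0// ltW.
have h_bounds j : 0 <= h j 0 <= norm1 h.
  by rewrite (ltW (h_gt0 j)) (le_trans (ler_norm _))// ler_coord_norm1.
exists (a / bmin * (2 * ctot + bmin + norm1 h)), (ctot * a / hmin + 1).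
have up0 : 0 <= ctot * a / hmin by rewrite divr_ge0 ?mulr_ge0// ltW.
have lowC0 : 0 < a / bmin * (2 * ctot + bmin + norm1 h).
  by rewrite mulr_gt0 ?divr_gt0//; have := norm1_ge0 h; lra.
split=> //; split; first by rewrite ltr_wpDl.
move=> K ns n_eq L _ _ d' T' Q rate N S Dem _ _ d T P D _ _.
subst n => A' h'; rewrite {}/A' {}/h' !castmx_id -/Ar => k y x _ ystar opt p.
have n0 := norm1_ge0 x.
have [fin|/forallPn[l]] := boolP [forall l : 'I_K, (l <= k)%N ==> (mean_size (D l) < +oo)%E];
  last first.
  (* An infinite mean makes both bounds infinite. *)
  rewrite negb_imply => /andP[lk /(expectation_norm1_future_infinite lk) ->].
  rewrite addey// addye// addye// !gt0_muley ?lte_fin ?ltr_wpDl//.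
  by rewrite leNye leey.
have {}fin (l : 'I_K) : (l <= k)%N -> (mean_size (D l) < +oo)%E.
  exact/implyP/(forallP fin l).
rewrite (expectation_norm1_future fin) -!EFinD -!EFinM -EFinN !lee_fin.
have cost_le : \sum_i block_cost Ar h b i 0 <= ctot by rewrite block_costE.
have hp0 : 0 < submxcol h k p 0 by rewrite mxE.
split.
  exact: (optimal_decision_ge A_bounds A_row_sum a0 h_bounds bmin0 bge cost_le p fin opt).
have := optimal_decision_le A_bounds A_row_sum a0 h_bounds bmin0 bge cost_le fin opt hp0.
move=> /le_trans; apply; set W := norm1 x + _.
have W0 : 0 <= W by rewrite addr_ge0// future_mean_ge0.
apply: (@le_trans _ _ (ctot * a / hmin * W)).
  by rewrite ler_wpM2r// ler_wpM2l ?mulr_ge0 ?(ltW a0)// lef_pV2// mxE.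
by rewrite -/W; nra.
Qed.
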